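(* Consider the regular partially labeled binary broadcasting tree $\text{Tree}_{k=2}(\theta,d,\delta)$ rooted at $\rho$ (see context), with $0<\theta<1$, and assume $\delta d=O(1)$. Let $M_t(\ell_{T_{\leq t}(\rho)})$ be the message computed by the approximate message passing recursion in the context. Define $\mu_1=\theta\delta d\log\frac{1+\theta}{1-\theta}$, $\sigma_1^2=\delta d\log^2\frac{1+\theta}{1-\theta}$, $\alpha=(1-\delta)\theta^2 d$, and for $t\geq 2$ $$\mu_t=\mu_1+\alpha\mu_{t-1},\qquad \sigma_t^2=\sigma_1^2+\alpha\sigma_{t-1}^2+\alpha\mu_{t-1}^2.$$ Then explicitly $$\mu_t=\frac{\alpha^t-1}{\alpha-1}\mu_1,\qquad \sigma_t^2=\frac{\alpha^t-1}{\alpha-1}\sigma_1^2+\frac{\frac{\alpha^{2t}-\alpha^{t+1}+\alpha^t-\alpha}{\alpha-1}-2(t-1)\alpha^t}{(\alpha-1)^2}\mu_1^2.$$ Moreover, for any depth $t$ and $x>0$, conditionally on $\ell(\rho)=+$, $\mu_t-x\sigma_t\leq M_t(\ell_{T_{\leq t}(\rho)})\leq \mu_t+x\sigma_t$, and conditionally on $\ell(\rho)=-$, $-\mu_t-x\sigma_t\leq M_t(\ell_{T_{\leq t}(\rho)})\leq -\mu_t+x\sigma_t$, each with probability at least $1-2\exp(-x^2/2)$.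
   Context: $\text{Tree}_{k=2}(\theta,d,\delta)$ (regular version): a rooted tree in which every vertex has $d$ children, exactly $\delta d$ of which have revealed labels and $(1-\delta)d$ of which are unlabeled (assume these are integers). The root label $\ell(\rho)\in\{+,-\}$ is unrevealed. Labels are broadcast from parent to child: a child receives its parent's label with probability $\frac{1+\theta}{2}$ and the opposite label with probability $\frac{1-\theta}{2}$, independently. $\ell_{T_{\leq t}(\rho)}$ denotes the revealed labels in the depth-$t$ tree. AMP recursion: for an unlabeled vertex $v$, $M_0(v)=0$, $M_1(v)=(N_+(v)-N_-(v))\log\frac{1+\theta}{1-\theta}$, where $N_\pm(v)$ is the number of labeled children of $v$ with label $\pm$, and $M_i(v)=M_1(v)+\theta\sum_{u\text{ unlabeled child of }v}M_{i-1}(u)$, computed bottom-up from the depth-$t$ layer; the output label is $\operatorname{sgn}(M_t(\rho))$. *)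

(* Defs.v *)
From HB Require Import structures.
From mathcomp Require Import all_boot all_order all_algebra.
From mathcomp Require Import reals sequences exp.
Set Implicit Arguments. Unset Strict Implicit. Unset Printing Implicit Defensive.
Import Order.TTheory GRing.Theory Num.Theory.
Local Open Scope ring_scope.

(* Regular tree in which every vertex has d children, indexed by 'I_d.
   A vertex is the path (seq 'I_d) from the root rho = [::]; the children of
   v are rcons v j, j : 'I_d.  Children j with j < a (a = delta*d) have
   revealed labels, children with a <= j are unlabeled.
   Labels: true = '+', false = '-'. *)

Section Tree.
Variable d : nat.

Fixpoint paths (i : nat) : seq (seq 'I_d) :=
  if i is i'.+1 then [seq rcons p j | p <- paths i', j <- enum 'I_d]
  else [:: [::]].

Definition verts (t : nat) : seq (seq 'I_d) :=
  flatten [seq paths i | i <- iota 0 t.+1].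

Definition vertex (t : nat) := seq_sub (verts t).

Definition config (t : nat) := {ffun vertex t -> bool}.

Definition lab (t : nat) (sg : config t) (v : seq 'I_d) : bool :=
  if (insub v : option (vertex t)) is Some u then sg u else false.

Definition parent (v : seq 'I_d) : seq 'I_d := take (size v).-1 v.

Variable R : realType.

Definition edgeP (theta : R) (p c : bool) : R :=
  if p == c then (1 + theta) / 2 else (1 - theta) / 2.

Definition weight (t : nat) (theta : R) (s : bool) (sg : config t) : R :=
  (lab sg [::] == s)%:R *
  \prod_(v : vertex t | val v != [::]) edgeP theta (lab sg (parent (val v))) (sg v).

Definition condP (t : nat) (theta : R) (s : bool) (E : pred (config t)) : R :=
  \sum_(sg : config t | E sg) weight theta s sg.

Definition LLR (theta : R) : R := ln ((1 + theta) / (1 - theta)).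

Definition M1 (t : nat) (a : nat) (theta : R) (sg : config t) (v : seq 'I_d) : R :=
  ((\sum_(j : 'I_d | (j < a)%N) (lab sg (rcons v j))%:R)
   - (\sum_(j : 'I_d | (j < a)%N) (~~ lab sg (rcons v j))%:R)) * LLR theta.

Fixpoint Msg (t : nat) (a : nat) (theta : R) (sg : config t) (i : nat)
  (v : seq 'I_d) : R :=
  match i with
  | 0 => 0
  | i'.+1 => M1 a theta sg v
             + theta * \sum_(j : 'I_d | (a <= j)%N) Msg a theta sg i' (rcons v j)
  end.

End Tree.

Section Params.
Variable R : realType.
Variables (theta delta : R) (d : nat).

Definition mu1 : R := theta * delta * d%:R * LLR theta.
Definition sigma1sq : R := delta * d%:R * LLR theta ^+ 2.
Definition alpha : R := (1 - delta) * theta ^+ 2 * d%:R.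

(* mu_t, sigma_t^2 for t >= 1 (the value at index 0 is unused) *)
Fixpoint mu (t : nat) : R :=
  match t with
  | 0 => 0
  | 1 => mu1
  | t'.+1 => mu1 + alpha * mu t'
  end.

Fixpoint sigmasq (t : nat) : R :=
  match t with
  | 0 => 0
  | 1 => sigma1sq
  | t'.+1 => sigma1sq + alpha * sigmasq t' + alpha * mu t' ^+ 2
  end.

End Params.

(* Main.v *)
Require Import Defs.
From HB Require Import structures.
From mathcomp Require Import all_boot all_order all_algebra.
From mathcomp Require Import classical_sets topology normedtype derive realfun.
From mathcomp Require Import reals sequences exp.
From mathcomp Require Import ring lra.
Set Implicit Arguments. Unset Strict Implicit. Unset Printing Implicit Defensive.
Import Order.TTheory GRing.Theory Num.Theory.
Import numFieldNormedType.Exports.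
Local Open Scope ring_scope.

(* Given the root label s, the message M_t is sub-Gaussian with mean s mu_t and
   variance proxy sigma_t^2, so Chernoff's bound applies.  Since M_t is a linear
   function of the labels, exp (lam M_t) is a product of one factor per vertex,
   and summing out the labels from the deepest layer upwards computes its mean by
   a recursion over subtrees.  In the inductive step a revealed child contributes
   a two-point variable, sub-Gaussian with variance proxy log^2((1+theta)/(1-theta)),
   and an unrevealed child of label c contributes theta times a sub-Gaussian
   variable of mean c mu_(t-1); Hoeffding's bound on the random sign c turns the
   latter into the terms alpha sigma_(t-1)^2 + alpha mu_(t-1)^2. *)

(** * Sub-Gaussian bound for a biased sign *)

Section TwoPoint.
Variable R : realType.

Lemma is_derive_le0_le (f df : R -> R) (y : R) :
  (forall x : R, is_derive x (1 : R) f (df x)) -> (forall x, 0 <= x -> df x <= 0) ->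
  0 <= y -> f y <= f 0.
Proof.
move=> fdf df_le0 y_ge0.
have fc : {within `[0, y], continuous f}%classic.
  apply: continuous_subspaceT => x.
  by apply/differentiable_continuous/derivable1_diffP; case: (fdf x).
have [c] := MVT_segment y_ge0 (fun x _ => fdf x) fc.
rewrite in_itv /= subr0 => /andP[c_ge0 _] fE.
by rewrite -subr_le0 fE mulr_le0_ge0 // df_le0.
Qed.

(** The cumulant generating function [ln (D x)] vanishes at 0 with slope [m], and its second
    derivative is [1 - (N x / D x) ^+ 2], hence at most 1. Integrating this bound twice, first
    through [u] and then through [f], gives [m * y + y ^+ 2 / 2]. *)
Lemma two_point_subgaussian_ge0 (m y : R) : -1 < m < 1 -> 0 <= y ->
  (1 + m) / 2 * expR y + (1 - m) / 2 * expR (- y) <= expR (m * y + y ^+ 2 / 2).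
Proof.
move=> /andP[m_gtN1 m_lt1] y_ge0.
pose p := (1 + m) / 2; pose q := (1 - m) / 2.
have p_gt0 : 0 < p by rewrite /p; lra.
have q_gt0 : 0 < q by rewrite /q; lra.
pose D x := p * expR x + q * expR (- x).
pose N x := p * expR x - q * expR (- x).
have D_gt0 x : 0 < D x by rewrite addr_gt0 // mulr_gt0 // expR_gt0.
have dD x : is_derive x (1 : R) D (N x).
  rewrite /D /N; apply: is_derive_eq; rewrite /GRing.scale /=; ring.
have dN x : is_derive x (1 : R) N (D x).
  rewrite /D /N; apply: is_derive_eq; rewrite /GRing.scale /=; ring.
pose u x := N x * (D x)^-1 - x.
have du x : is_derive x (1 : R) u (- (N x / D x) ^+ 2).
  have dV := is_deriveV (lt0r_neq0 (D_gt0 x)) (dD x).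
  rewrite /u; apply: is_derive_eq; rewrite /GRing.scale /=.
  by field; rewrite lt0r_neq0.
have u0 : u 0 = m.
  by rewrite /u /N /D oppr0 expR0 /p /q; field; rewrite ?(lt0r_neq0 (D_gt0 0)); lra.
pose f x := ln (D x) - (m * x + x ^+ 2 / 2).
have df x : is_derive x (1 : R) f (N x / D x - m - x).
  have dln := is_derive1_ln (D_gt0 x).
  have dlnD := is_derive1_comp dln (dD x).
  have dl : is_derive x (1 : R) (fun x => ln (D x)) ((D x)^-1 * N x) by [].
  rewrite /f; apply: is_derive_eq; rewrite /GRing.scale /=.
  by field; rewrite lt0r_neq0.
have : f y <= f 0.
  apply: is_derive_le0_le df _ y_ge0 => x x_ge0.
  have : u x <= u 0.
    by apply: is_derive_le0_le du _ x_ge0 => z _; rewrite oppr_le0 sqr_ge0.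
  rewrite u0 /u; lra.
rewrite /f /D oppr0 expR0 -/p -/q.
have -> : p * 1 + q * 1 = 1 by rewrite /p /q; field.
rewrite ln1 expr0n /= mul0r mulr0 addr0 subr0 subr_le0 => h.
by rewrite -[leLHS](lnK (D_gt0 y)) ler_expR.
Qed.

Lemma two_point_subgaussian (m y : R) : -1 < m < 1 ->
  (1 + m) / 2 * expR y + (1 - m) / 2 * expR (- y) <= expR (m * y + y ^+ 2 / 2).
Proof.
move=> m1; case: (lerP 0 y) => y0; first exact: two_point_subgaussian_ge0.
(* Exchanging the two outcomes turns [(m, y)] into [(- m, - y)] and preserves the inequality. *)
have := @two_point_subgaussian_ge0 (- m) (- y).
rewrite !opprK mulrNN sqrrN addrC; apply; [lra|by rewrite oppr_ge0 ltW].
Qed.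
End TwoPoint.

Local Arguments paths : simpl never.
Local Arguments verts : simpl never.

(** * The vertices of the truncated tree, layer by layer *)

Section Verts.
Variable d : nat.
Implicit Types (t i : nat) (v : seq 'I_d).

Lemma mem_paths i v : (v \in paths d i) = (size v == i).
Proof.
elim: i v => [|i IHi] v; first by rewrite /paths inE size_eq0.
apply/allpairsP/eqP => [[[p j] /= [pP _ ->]]|].
  by rewrite size_rcons; move: pP; rewrite IHi => /eqP->.
case/lastP: v => // p j; rewrite size_rcons => -[szp].
by exists (p, j); rewrite IHi szp mem_enum eqxx.
Qed.

Lemma paths_uniq i : uniq (paths d i).
Proof.
elim: i => // i IHi; apply: allpairs_uniq => //; first exact: enum_uniq.
by move=> [p j] [q k] _ _ /= /rcons_inj[-> ->].
Qed.

Lemma vertsS t : verts d t.+1 = verts d t ++ paths d t.+1.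
Proof.
by rewrite /verts -[in iota _ _](addn1 t.+1) iotaD map_cat flatten_cat /= cats0.
Qed.

Lemma big_vertsS (R : Type) (idx : R) (op : Monoid.law idx) t (F : seq 'I_d -> R) :
  \big[op/idx]_(v <- verts d t.+1) F v =
  op (\big[op/idx]_(v <- verts d t) F v) (\big[op/idx]_(v <- paths d t.+1) F v).
Proof. by rewrite vertsS big_cat. Qed.

Lemma mem_verts t v : (v \in verts d t) = (size v <= t)%N.
Proof.
elim: t => [|t IHt]; first by rewrite /verts /= inE leqn0 size_eq0.
by rewrite vertsS mem_cat IHt mem_paths [in RHS]leq_eqVlt ltnS orbC.
Qed.

Lemma verts_uniq t : uniq (verts d t).
Proof.
elim: t => // t IHt; rewrite vertsS cat_uniq IHt paths_uniq andbT.
by apply/hasPn => v; rewrite mem_paths mem_verts => /eqP->; rewrite ltnn.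
Qed.

Lemma size_vertex t (u : vertex d t) : (size (val u) <= t)%N.
Proof. by rewrite -mem_verts; exact: valP. Qed.

Lemma lab_val t (sg : config d t) (u : vertex d t) : lab sg (val u) = sg u.
Proof. by rewrite /lab valK. Qed.

Lemma parent_rcons v (j : 'I_d) : parent (rcons v j) = v.
Proof. by rewrite /parent size_rcons -cats1 take_size_cat. Qed.

Lemma big_vertex (R : Type) (idx : R) (op : Monoid.com_law idx) t
    (F : seq 'I_d -> R) :
  \big[op/idx]_(u : vertex d t) F (val u) = \big[op/idx]_(v <- verts d t) F v.
Proof.
rewrite -(big_map val predT F); apply: perm_big; apply: uniq_perm.
- by rewrite map_inj_uniq ?index_enum_uniq //; exact: val_inj.
- exact: verts_uniq.
move=> v; apply/mapP/idP => [[u _ ->]|vv]; first exact: valP.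
by exists (SeqSub vv); rewrite ?mem_index_enum.
Qed.

Lemma big_paths_rcons (R : Type) (idx : R) (op : Monoid.com_law idx) t
    (F : seq 'I_d -> R) :
  \big[op/idx]_(v <- paths d t.+1) F v =
  \big[op/idx]_(v <- paths d t) \big[op/idx]_(j < d) F (rcons v j).
Proof.
rewrite big_allpairs_dep /=; apply: eq_bigr => v _.
by rewrite big_enum.
Qed.

(** The induction on the depth sums over the fibres of this map, whose members differ only in the
    deepest layer. *)
Definition restrict t (sg : config d t.+1) : config d t :=
  [ffun u : vertex d t => lab sg (val u)].

Lemma lab_restrict t (sg : config d t.+1) v :
  (size v <= t)%N -> lab (restrict sg) v = lab sg v.
Proof.
move=> szv; have vv : v \in verts d t by rewrite mem_verts.
by rewrite -[v]/(val (SeqSub vv)) lab_val ffunE.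
Qed.

End Verts.

(** * Summing out the labels from the deepest layer upwards *)

Section Recursion.
Variables (R : realType) (d : nat) (theta : R).
Implicit Types (g : seq 'I_d -> bool -> R) (v : seq 'I_d) (s c : bool).

Fixpoint subtree_prod (G : seq 'I_d -> R) i v : R :=
  if i is i'.+1 then G v * \prod_(j < d) subtree_prod G i' (rcons v j) else G v.

(** This is the conditional expectation, given label [s] at [v], of the product of [g] over the
    descendants of [v] down to [i] generations. *)
Fixpoint subtree_mean g i v s : R :=
  if i is i'.+1 then
    g v s * \prod_(j < d) \sum_c edgeP theta s c * subtree_mean g i' (rcons v j) c
  else g v s.

Lemma eq_subtree_prod G G' i v :
  (forall w, (size v <= size w <= size v + i)%N -> G w = G' w) ->
  subtree_prod G i v = subtree_prod G' i v.
Proof.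
elim: i v => [|i IHi] v GG' /=; first by apply: GG'; rewrite addn0 leqnn.
rewrite GG' ?leqnn ?leq_addr //; congr (_ * _); apply: eq_bigr => j _.
apply: IHi => w; rewrite size_rcons => /andP[vw wi].
by apply: GG'; rewrite ltnW //= -addSnnS.
Qed.

(** The definition unfolds at the top, whereas the induction on the depth removes the deepest layer.
    Here that layer is absorbed into the factors of the layer just above it. *)
Lemma subtree_prodS G i v : subtree_prod G i.+1 v =
  subtree_prod (fun w => if size w == (size v + i)%N
    then G w * \prod_(j < d) G (rcons w j) else G w) i v.
Proof.
elim: i v => [|i IHi] v; first by rewrite /= addn0 eqxx.
rewrite [LHS]/= [RHS]/= ifF; last by rewrite -[X in X == _]addn0 eqn_add2l.
congr (_ * _); apply: eq_bigr => j _; have /= -> := IHi (rcons v j).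
by apply: eq_subtree_prod => w _; rewrite size_rcons addSnnS.
Qed.

Lemma subtree_meanS g i v s : subtree_mean g i.+1 v s =
  subtree_mean (fun w r => if size w == (size v + i)%N
    then g w r * \prod_(j < d) \sum_c edgeP theta r c * g (rcons w j) c
    else g w r) i v s.
Proof.
elim: i v s => [|i IHi] v s; first by rewrite /= addn0 eqxx.
rewrite [LHS]/= [RHS]/= ifF; last by rewrite -[X in X == _]addn0 eqn_add2l.
congr (_ * _); apply: eq_bigr => j _; apply: eq_bigr => c _; congr (_ * _).
by have /= -> := IHi (rcons v j) c; rewrite size_rcons addSnnS.
Qed.

Lemma prod_paths_split (F G : seq 'I_d -> R) t :
  (\prod_(v <- verts d t) F v) * \prod_(v <- paths d t) G v =
  \prod_(v <- verts d t) (if size v == t then F v * G v else F v).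
Proof.
have E v : (if size v == t then F v * G v else F v) =
           F v * (if size v == t then G v else 1) by case: ifP; rewrite ?mulr1.
under [RHS]eq_bigr do rewrite E.
rewrite big_split /=; congr (_ * _); case: t {E} => [|t].
  by rewrite /verts /= !big_seq1.
rewrite big_vertsS /= [X in _ = X * _]big1_seq ?mul1r; last first.
  move=> v /andP[_]; rewrite mem_verts => szv.
  by rewrite ifF //; apply/negbTE; rewrite neq_ltn ltnS szv.
apply: eq_big_seq => v vp.
by have := mem_paths t.+1 v; rewrite vp => <-.
Qed.

Lemma prod_verts_subtree G t :
  \prod_(v <- verts d t) G v = subtree_prod G t [::].
Proof.
elim: t G => [|t IHt] G; first by rewrite /verts /= big_seq1.
rewrite subtree_prodS -IHt big_vertsS big_paths_rcons /=.
by rewrite (@prod_paths_split G (fun v => \prod_(j < d) G (rcons v j))).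
Qed.

(** Treating the root indicator as one more factor makes [weight] a single product over [verts],
    from which the last layer splits off. *)
Definition vertex_factor t s (sg : config d t) v : R :=
  if v == [::] then (lab sg v == s)%:R else edgeP theta (lab sg (parent v)) (lab sg v).

Lemma weightE t s (sg : config d t) :
  weight theta s sg = \prod_(v <- verts d t) vertex_factor s sg v.
Proof.
have vt : [::] \in verts d t by rewrite mem_verts.
rewrite -(big_vertex _ t (vertex_factor s sg)).
rewrite (bigD1 (SeqSub vt)) //=; congr (_ * _).
by apply: eq_big => [u|u u0]; rewrite ?/vertex_factor ?(negbTE u0) ?lab_val.
Qed.

(** A fibre of [restrict] is a product set, free on the last layer and pinned elsewhere; this is the
    form needed to distribute a product over sums. *)
Lemma restrict_family t (sg : config d t) (sg' : config d t.+1) :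
  (restrict sg' == sg) =
  (sg' \in family (fun u c => (size (val u) == t.+1) || (c == lab sg (val u)))).
Proof.
apply/eqP/familyP => [<- u|sg'P].
  rewrite unfold_in; case: eqP => //= szu; rewrite lab_restrict ?lab_val //.
  by rewrite -ltnS ltn_neqAle size_vertex andbT; apply/eqP.
apply/ffunP => u; rewrite ffunE.
have uv : val u \in verts d t.+1 by rewrite mem_verts leqW ?size_vertex.
have := sg'P (SeqSub uv); rewrite unfold_in /= ltn_eqF ?ltnS ?size_vertex //=.
by rewrite lab_val => /eqP<-; rewrite -[val u]/(val (SeqSub uv)) lab_val.
Qed.

(** Product and sum exchange because the fibre is a product set. [K] pads the upper vertices with 1:
    their label is pinned to one value, so their inner sum is 1. *)
Lemma sum_last_layer t (sg : config d t) (k : seq 'I_d -> bool -> R) :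
  \sum_(sg' : config d t.+1 | restrict sg' == sg)
     \prod_(v <- paths d t.+1) k v (lab sg' v) =
  \prod_(v <- paths d t.+1) \sum_c k v c.
Proof.
pose K (u : vertex d t.+1) c := if size (val u) == t.+1 then k (val u) c else 1.
have pathsE (F : seq 'I_d -> R) : \prod_(v <- paths d t.+1) F v =
    \prod_(u : vertex d t.+1) (if size (val u) == t.+1 then F (val u) else 1).
  rewrite (big_vertex _ _ (fun v => if size v == t.+1 then F v else 1)).
  have := prod_paths_split (fun=> 1) F t.+1; rewrite [X in X * _]big1 // mul1r => ->.
  by apply: eq_bigr => v _; rewrite mul1r.
rewrite pathsE (eq_bigl _ _ (restrict_family sg)).
under eq_bigr => sg' _.
  rewrite pathsE; under eq_bigr do rewrite lab_val -/(K _ _).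
  over.
rewrite -(bigA_distr_big_dep _ K); apply: eq_bigr => u _; rewrite /K.
by case: ifP => //= _; rewrite (big_pred1 (lab sg (val u))).
Qed.

(** Given the labels down to depth [t], those of the next layer are independent. Summing them out
    leaves a function of each parent's label, which [subtree_meanS] treats as part of a new [g];
    hence the induction is over all [g]. *)
Lemma sum_weight_subtree t s g :
  \sum_(sg : config d t) weight theta s sg * \prod_(v <- verts d t) g v (lab sg v)
  = subtree_mean g t [::] s.
Proof.
elim: t g => [|t IHt] g.
  have vt : [::] \in verts d 0 by rewrite mem_verts.
  (* At depth 0 a configuration is just the label of the root. *)
  pose c2f (c : bool) : config d 0 := [ffun=> c].
  rewrite (reindex_onto c2f (fun sg => sg (SeqSub vt))) /=; last first.
    move=> sg _; apply/ffunP => u; rewrite ffunE; congr (sg _); apply/val_inj.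
    by apply/esym/eqP; rewrite -size_eq0 -leqn0 size_vertex.
  rewrite (eq_bigl predT) => [|c]; last by rewrite ffunE eqxx.
  have labE c : lab (c2f c) [::] = c.
    by rewrite -[[::]]/(val (SeqSub vt)) lab_val ffunE.
  under eq_bigr do rewrite weightE /verts /= !big_seq1 /vertex_factor eqxx labE.
  rewrite (bigD1 s) //= eqxx mul1r big1 ?addr0 // => c /negbTE->.
  by rewrite mul0r.
rewrite subtree_meanS -IHt (partition_big (@restrict d t) predT) //=.
apply: eq_bigr => sg _.
pose k v c := edgeP theta (lab sg (parent v)) c * g v c.
(* All factors down to depth [t] are constant on the fibre and leave the sum. *)
transitivity (weight theta s sg * (\prod_(v <- verts d t) g v (lab sg v))
   * \sum_(sg' : config d t.+1 | restrict sg' == sg)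
       \prod_(v <- paths d t.+1) k v (lab sg' v)).
  rewrite big_distrr /=; apply: eq_bigr => sg' /eqP sgE.
  rewrite /k -sgE !weightE !big_vertsS big_split /= -!mulrA; congr (_ * _).
    apply: eq_big_seq => v; rewrite mem_verts => szv; rewrite /vertex_factor.
    rewrite !lab_restrict // (leq_trans _ szv) //.
    by rewrite /parent size_take; case: ltnP => // _; rewrite leq_pred.
  rewrite mulrCA; congr (_ * _).
    by apply: eq_big_seq => v; rewrite mem_verts => szv; rewrite lab_restrict.
  congr (_ * _); apply: eq_big_seq => v; rewrite mem_paths.
  case/lastP: v => // v j; rewrite size_rcons eqSS => /eqP szv.
  rewrite /vertex_factor parent_rcons lab_restrict ?szv //.
  by case: ifP => // /eqP; case: (v).
rewrite sum_last_layer big_paths_rcons -mulrA; congr (_ * _).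
rewrite (@prod_paths_split _ (fun v => \prod_(j < d) \sum_c k (rcons v j) c)).
apply: eq_bigr => v _; rewrite add0n; case: ifP => // _; congr (_ * _).
by apply: eq_bigr => j _; apply: eq_bigr => c _; rewrite /k parent_rcons.
Qed.

End Recursion.

(** * Two-sided Chernoff bound on a finite space *)

Section Chernoff.
Variable R : realType.

Lemma chernoff_two_sided (T : finType) (w X : T -> R) (m v x : R) :
  (forall i, 0 <= w i) -> \sum_i w i = 1 ->
  (forall lam, \sum_i w i * expR (lam * X i) <= expR (lam * m + lam ^+ 2 * v / 2)) ->
  0 < v -> 0 <= x ->
  1 - 2 * expR (- (x ^+ 2) / 2) <=
  \sum_(i | (m - x * Num.sqrt v <= X i) && (X i <= m + x * Num.sqrt v)) w i.
Proof.
move=> w_ge0 w1 mgf v_gt0 x_ge0.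
set s := Num.sqrt v; have s_gt0 : 0 < s by rewrite sqrtr_gt0.
have vE : v = s ^+ 2 by rewrite sqr_sqrtr // ltW.
(* The choice [x / s] minimizes the Chernoff exponent [lam ^+ 2 * v / 2 - lam * x * s], with minimum
   [- x ^+ 2 / 2]. *)
have [lam lam_ge0 lamE] : exists2 lam, 0 <= lam & lam * s = x.
  by exists (x / s); [rewrite divr_ge0 // ltW | rewrite divfK // gt_eqF].
pose E i := (m - x * s <= X i) && (X i <= m + x * s).
rewrite -[X in X - _]w1 (bigID E) /= -addrA gerDl subr_le0.
(* The two summands are the Markov majorants of the upper and lower tails, with tilts [lam] and
   [- lam]; the threshold enters as [lam * (x * s) = x ^+ 2]. *)
pose b i := w i * expR (lam * X i) * expR (- (lam * m) - x ^+ 2)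
  + w i * expR (- lam * X i) * expR (lam * m - x ^+ 2).
have tail : \sum_(i | ~~ E i) w i <= \sum_i b i.
  rewrite [leRHS](bigID (fun i => ~~ E i)) /= -[leLHS]addr0 lerD //; last first.
    by apply: sumr_ge0 => i _; rewrite addr_ge0 // !mulr_ge0 ?expR_ge0.
  apply: ler_sum => i; rewrite negb_and -!ltNge /b -!mulrA -!expRD -mulrDr => Ei.
  have xE : x ^+ 2 = lam * (x * s) by rewrite mulrCA lamE.
  have ge1 u z : 0 <= z -> 1 <= expR u + expR z.
    by move=> z_ge0; rewrite ler_wpDl ?expR_ge0 // -expR0 ler_expR.
  rewrite ler_peMr // xE; case/orP: Ei => Xi; last rewrite addrC.
    apply: ge1; have -> : - lam * X i + (lam * m - lam * (x * s))
      = lam * (m - x * s - X i) by ring.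
    by rewrite mulr_ge0 // subr_ge0 ltW.
  apply: ge1; have -> : lam * X i + (- (lam * m) - lam * (x * s))
    = lam * (X i - (m + x * s)) by ring.
  by rewrite mulr_ge0 // subr_ge0 ltW.
apply: (le_trans tail); rewrite /b big_split /= -!mulr_suml.
have -> : 2 * expR (- (x ^+ 2) / 2)
  = expR (lam * m + lam ^+ 2 * v / 2) * expR (- (lam * m) - x ^+ 2)
  + expR (- lam * m + (- lam) ^+ 2 * v / 2) * expR (lam * m - x ^+ 2).
  rewrite -!expRD vE -lamE mulr_natl mulr2n; congr (expR _ + expR _); by field.
by rewrite lerD // ler_wpM2r ?expR_ge0.
Qed.

End Chernoff.

(** * Exponential moments of the AMP message *)

Section Broadcast.
Variables (R : realType) (d a : nat) (delta theta : R).
Hypotheses (hdelta : delta * d%:R = a%:R) (had : (a <= d)%N).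
Hypothesis hdelta1 : delta <= 1.
Hypotheses (htheta0 : 0 < theta) (htheta1 : theta < 1).
Implicit Types (s c : bool) (v : seq 'I_d) (lam : R).

Local Notation L := (LLR theta).
Local Notation mu := (mu theta delta d).
Local Notation sigmasq := (sigmasq theta delta d).
Local Notation alpha := (alpha theta delta d).
Local Notation sgn c := ((-1) ^+ (~~ c) : R).

Lemma edgeP_ge0 s c : 0 <= edgeP theta s c.
Proof.
rewrite /edgeP; case: ifP => _; rewrite divr_ge0 // ?subr_ge0 ?addr_ge0 //.
all: exact: ltW.
Qed.

Lemma sum_edgeP s : \sum_c edgeP theta s c = 1.
Proof. by rewrite big_bool /edgeP; case: s => /=; field. Qed.

Lemma weight_ge0 t s (sg : config d t) : 0 <= weight theta s sg.
Proof. by rewrite mulr_ge0 ?ler0n // prodr_ge0 // => v _; exact: edgeP_ge0. Qed.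

Lemma sum_weight t s : \sum_(sg : config d t) weight theta s sg = 1.
Proof.
have mean1 i v c : subtree_mean theta (fun _ _ => 1) i v c = 1.
  elim: i v c => //= i IHi v c; rewrite mul1r big1 // => j _.
  by under eq_bigr do rewrite IHi mulr1; exact: sum_edgeP.
rewrite -(mean1 t [::] s) -sum_weight_subtree.
by apply: eq_bigr => sg _; rewrite big1 ?mulr1.
Qed.

(** The sign of a child is a two-point variable of mean [theta] under a positive parent and
    [- theta] under a negative one. *)
Lemma edgeP_subgaussian s (y : R) :
  \sum_c edgeP theta s c * expR (sgn c * y) <= expR (sgn s * (theta * y) + y ^+ 2 / 2).
Proof.
have h1 : -1 < theta < 1 by rewrite htheta1 (lt_trans _ htheta0) ?ltrN10.
have h2 : -1 < - theta < 1 by rewrite ltrN2 htheta1 (lt_trans _ ltr01) ?oppr_lt0.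
rewrite big_bool /edgeP; case: s => /=; rewrite expr0 expr1 !mul1r !mulN1r.
  exact: two_point_subgaussian.
by have := two_point_subgaussian y h2; rewrite opprK mulNr.
Qed.

(** The condition bears on the whole path: [v] and all its ancestors are unrevealed, the root being
    the empty path. Only the messages of such vertices enter the message of the root. *)
Definition unlabeled v := all (fun j : 'I_d => (a <= j)%N) v.

(* [expR (lam * Msg)] is the product of these factors over the revealed
   vertices whose proper ancestors are all unrevealed. *)
Definition tilt lam v c : R :=
  if unlabeled (parent v) && ~~ unlabeled v
  then expR (lam * theta ^+ (size v).-1 * (sgn c * L)) else 1.

Lemma unlabeled_rcons v j : unlabeled (rcons v j) = (a <= j)%N && unlabeled v.
Proof. exact: all_rcons. Qed.

Lemma tilt_unlabeled lam v c : unlabeled v -> tilt lam v c = 1.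
Proof. by rewrite /tilt => ->; rewrite andbF. Qed.

Lemma tilt_labeled lam v (j : 'I_d) c : unlabeled v -> (j < a)%N ->
  tilt lam (rcons v j) c = expR (lam * theta ^+ size v * (sgn c * L)).
Proof.
move=> uv ja; rewrite /tilt parent_rcons unlabeled_rcons uv leqNgt ja.
by rewrite size_rcons.
Qed.

Lemma tilt_below lam v j c : ~~ unlabeled v -> tilt lam (rcons v j) c = 1.
Proof. by rewrite /tilt parent_rcons => /negbTE->. Qed.

Lemma rcons_labeled v (j : 'I_d) : (j < a)%N -> ~~ unlabeled (rcons v j).
Proof. by move=> ja; rewrite unlabeled_rcons leqNgt ja. Qed.

Lemma subtree_prod_tilt_labeled lam (f : seq 'I_d -> bool) i v : ~~ unlabeled v ->
  subtree_prod (fun w => tilt lam w (f w)) i v = tilt lam v (f v).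
Proof.
elim: i v => //= i IHi v uv; rewrite big1 ?mulr1 // => j _.
by rewrite IHi ?tilt_below // unlabeled_rcons (negbTE uv) andbF.
Qed.

(** At or below a revealed vertex, every strict descendant has factor 1, and the transition
    probabilities sum to 1, so the subtree drops out. *)
Lemma subtree_mean_tilt_labeled lam i v s : ~~ unlabeled v ->
  subtree_mean theta (tilt lam) i v s = tilt lam v s.
Proof.
elim: i v s => //= i IHi v s uv; rewrite big1 ?mulr1 // => j _.
rewrite -[RHS](sum_edgeP s); apply: eq_bigr => c _.
by rewrite IHi ?tilt_below ?mulr1 // unlabeled_rcons (negbTE uv) andbF.
Qed.

Lemma subtree_mean_tilt_ge0 lam i v s : 0 <= subtree_mean theta (tilt lam) i v s.
Proof.
have tilt_ge0 w c : 0 <= tilt lam w c by rewrite /tilt; case: ifP; rewrite ?expR_ge0.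
elim: i v s => //= i IHi v s; rewrite mulr_ge0 // prodr_ge0 // => j _.
by rewrite sumr_ge0 // => c _; rewrite mulr_ge0 ?edgeP_ge0.
Qed.

Lemma M1E t (sg : config d t) v :
  M1 a theta sg v = \sum_(j < d | (j < a)%N) sgn (lab sg (rcons v j)) * L.
Proof.
rewrite /M1 -sumrB mulr_suml; apply: eq_bigr => j _.
by case: (lab _ _); rewrite /= ?expr0 ?expr1 ?subr0 ?sub0r.
Qed.

(** The message of [v] reaches the root multiplied by one [theta] per generation, whence the scale
    [theta ^+ size v], which matches the exponent in [tilt]. *)
Lemma expR_Msg t (sg : config d t) lam i v : unlabeled v ->
  expR (lam * theta ^+ size v * Msg a theta sg i v) =
  subtree_prod (fun w => tilt lam w (lab sg w)) i v.
Proof.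
elim: i v => [|i IHi] v uv; first by rewrite /= mulr0 expR0 tilt_unlabeled.
rewrite /= tilt_unlabeled // mul1r [RHS](bigID (fun j : 'I_d => (j < a)%N)) /=.
set y := lam * _; rewrite mulrDr expRD M1E (mulrA y) !mulr_sumr !expR_sum.
congr (_ * _).
  apply: eq_bigr => j ja.
  by rewrite subtree_prod_tilt_labeled ?rcons_labeled // tilt_labeled.
apply: eq_big => [j|j ja]; first by rewrite -leqNgt.
by rewrite -IHi ?unlabeled_rcons ?ja // size_rcons exprSr mulrA.
Qed.

Lemma sum_ord_threshold (A B : R) :
  \sum_(j < d) (if (j < a)%N then A else B) = a%:R * A + (d - a)%:R * B.
Proof.
rewrite -(big_mkord predT (fun j => if (j < a)%N then A else B)).
rewrite (big_cat_nat (n := a)) //=; congr (_ + _).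
  rewrite (eq_big_nat _ _ (F2 := fun=> A)) => [|j /andP[_ ->] //].
  by rewrite sumr_const_nat subn0 mulr_natl.
rewrite (eq_big_nat _ _ (F2 := fun=> B)) => [|j /andP[aj _]].
  by rewrite sumr_const_nat mulr_natl.
by rewrite ltnNge aj.
Qed.

(** The value 0 at index 0 makes the recursions hold from there on, so inductions can start at the
    zero message. *)
Lemma muS i : mu i.+1 = mu1 theta delta d + alpha * mu i.
Proof. by case: i => //=; rewrite mulr0 addr0. Qed.

Lemma sigmasqS i : sigmasq i.+1 =
  sigma1sq theta delta d + alpha * sigmasq i + alpha * mu i ^+ 2.
Proof. by case: i => //=; rewrite expr0n !mulr0 !addr0. Qed.

Lemma subtree_mean_tilt_le lam i v s : unlabeled v ->
  subtree_mean theta (tilt lam) i v s <=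
  expR (sgn s * (lam * theta ^+ size v * mu i)
        + (lam * theta ^+ size v) ^+ 2 * sigmasq i / 2).
Proof.
elim: i v s => [|i IHi] v s uv.
  by rewrite /= tilt_unlabeled // !(mulr0, mul0r) addr0 expR0.
rewrite /= tilt_unlabeled // mul1r; set y := lam * theta ^+ size v.
(* [A] is the log-bound for a revealed child. [B] is that for an unrevealed child: the variance term
   of the induction hypothesis at tilt [y * theta], plus the bound for the child's random sign
   multiplying [y * theta * mu i]. *)
pose A := sgn s * (theta * (y * L)) + (y * L) ^+ 2 / 2.
pose B := (y * theta) ^+ 2 * sigmasq i / 2
  + (sgn s * (theta * (y * theta * mu i)) + (y * theta * mu i) ^+ 2 / 2).
(* With [delta * d] copies of [A] and [(1 - delta) * d] copies of [B], the total is exactly the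
   recursion for [mu] and [sigmasq]. *)
have -> : sgn s * (y * mu i.+1) + y ^+ 2 * sigmasq i.+1 / 2
  = \sum_(j < d) (if (j < a)%N then A else B).
  rewrite sum_ord_threshold natrB // -hdelta muS sigmasqS /A /B.
  by rewrite /mu1 /sigma1sq /Defs.alpha; field.
rewrite expR_sum; apply: ler_prod => j _; apply/andP; split.
  by rewrite sumr_ge0 // => c _; rewrite mulr_ge0 ?edgeP_ge0 ?subtree_mean_tilt_ge0.
case: ltnP => ja.
  apply: le_trans (edgeP_subgaussian s (y * L)).
  apply: ler_sum => c _; rewrite ler_wpM2l ?edgeP_ge0 //.
  by rewrite subtree_mean_tilt_labeled ?rcons_labeled // tilt_labeled // mulrCA.
(* The variance term of [B] does not depend on the child's label [c], so only the sign is
   averaged. *)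
rewrite expRD; apply: le_trans (ler_wpM2l (expR_ge0 _) (edgeP_subgaussian s _)).
rewrite mulr_sumr; apply: ler_sum => c _; rewrite mulrCA -expRD.
rewrite ler_wpM2l ?edgeP_ge0 //; apply: le_trans (IHi _ _ _) _.
  by rewrite unlabeled_rcons ja.
by rewrite size_rcons exprSr (mulrA lam) -/y addrC.
Qed.

Lemma Msg_subgaussian t s lam :
  \sum_(sg : config d t) weight theta s sg * expR (lam * Msg a theta sg t [::])
  <= expR (lam * (sgn s * mu t) + lam ^+ 2 * sigmasq t / 2).
Proof.
have := @subtree_mean_tilt_le lam t [::] s isT.
rewrite expr0 mulr1 mulrCA; apply: le_trans.
rewrite -sum_weight_subtree; apply: ler_sum => sg _.
have := expR_Msg sg lam t (isT : unlabeled [::]); rewrite expr0 mulr1 => ->.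
by rewrite (prod_verts_subtree (fun w => tilt lam w (lab sg w))).
Qed.

(** * Zero variance and the concentration bound *)

Lemma alpha_ge0 : 0 <= alpha.
Proof. by rewrite mulr_ge0 ?ler0n // mulr_ge0 ?subr_ge0 ?sqr_ge0. Qed.

Lemma sigmasq_ge0 i : 0 <= sigmasq i.
Proof.
elim: i => // i IHi; rewrite sigmasqS /sigma1sq hdelta.
by rewrite !addr_ge0 // mulr_ge0 ?alpha_ge0 ?sqr_ge0.
Qed.

(** The Chernoff tilt divides by the standard deviation, so zero variance is handled apart. The
    recursion adds nonnegative terms, so [sigma1sq] must vanish; this forces the means and the
    messages to be 0. *)
Lemma sigmasq_eq0 t : sigmasq t.+1 = 0 -> a%:R * L = 0.
Proof.
move=> /eqP; rewrite sigmasqS /sigma1sq hdelta -addrA paddr_eq0; last 2 first.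
- by rewrite mulr_ge0 ?sqr_ge0.
- by rewrite addr_ge0 // mulr_ge0 ?alpha_ge0 ?sigmasq_ge0 ?sqr_ge0.
by case/andP => /eqP aL _; apply/eqP; move/eqP: aL; rewrite !mulf_eq0 orbb.
Qed.

Lemma mu_degenerate t : a%:R * L = 0 -> mu t = 0.
Proof.
move=> aL; elim: t => // t IHt; rewrite muS IHt mulr0 addr0 /mu1.
by rewrite -mulrA mulrA -(mulrA theta) hdelta -mulrA aL mulr0.
Qed.

Lemma Msg_degenerate t (sg : config d t) i v :
  a%:R * L = 0 -> Msg a theta sg i v = 0.
Proof.
move=> aL; elim: i v => // i IHi v /=.
rewrite big1 ?mulr0 ?addr0 // M1E.
move/eqP: aL; rewrite mulf_eq0 pnatr_eq0 => /orP[/eqP a0|/eqP L0].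
  by rewrite big_pred0 // => j; rewrite a0.
by rewrite L0 big1 // => j _; rewrite mulr0.
Qed.

Lemma Msg_concentration t s (x : R) : (1 <= t)%N -> 0 < x ->
  1 - 2 * expR (- (x ^+ 2) / 2) <=
  condP theta s [pred sg : config d t |
    (sgn s * mu t - x * Num.sqrt (sigmasq t) <= Msg a theta sg t [::])
    && (Msg a theta sg t [::] <= sgn s * mu t + x * Num.sqrt (sigmasq t))].
Proof.
move=> t_ge1 x_gt0; rewrite /condP /=.
have [v0|v_neq0] := eqVneq (sigmasq t) 0; last first.
  apply: chernoff_two_sided => [sg||lam||]; first exact: weight_ge0.
  - exact: sum_weight.
  - exact: Msg_subgaussian.
  - by rewrite lt0r v_neq0 sigmasq_ge0.
  - exact: ltW.
case: t t_ge1 v0 => // t _ v0; have aL := sigmasq_eq0 v0.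
(* The interval shrinks to the point 0, where the message lies, so the event has probability 1. *)
rewrite (eq_bigl predT) => [|sg]; last first.
  by rewrite v0 sqrtr0 (mu_degenerate _ aL) (Msg_degenerate _ _ _ aL) !mulr0 subr0 addr0 lexx.
by rewrite sum_weight gerBl mulr_ge0 // expR_ge0.
Qed.

(** * Closed forms of the recursions *)

Hypothesis alpha1 : alpha != 1.

Lemma mu_closed t : mu t = (alpha ^+ t - 1) / (alpha - 1) * mu1 theta delta d.
Proof.
have a1 : alpha - 1 != 0 by rewrite subr_eq0.
elim: t => [|t IHt]; first by rewrite expr0 subrr !mul0r.
by rewrite muS IHt exprS; field.
Qed.

Lemma sigmasq_closed t : (1 <= t)%N -> sigmasq t =
  (alpha ^+ t - 1) / (alpha - 1) * sigma1sq theta delta d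
  + ((alpha ^+ (2 * t) - alpha ^+ t.+1 + alpha ^+ t - alpha) / (alpha - 1)
     - 2 * (t - 1)%:R * alpha ^+ t) / (alpha - 1) ^+ 2 * mu1 theta delta d ^+ 2.
Proof.
have a1 : alpha - 1 != 0 by rewrite subr_eq0.
(* The induction starts at 1, where the coefficient of [mu1 ^+ 2] is 0. At index 0 the truncated
   [t - 1] would leave [-2 / (alpha - 1) ^+ 2] instead. *)
case: t => // t _; elim: t => [|t IHt].
  by rewrite subnn muln1 !expr1 /=; field.
rewrite sigmasqS IHt mu_closed !subn1 /= !mul2n -!addnn !exprD !exprS -natr1.
by field.
Qed.

End Broadcast.

Theorem theorem2 (R : realType) (d a : nat) (delta theta : R)
  (hdelta : delta * d%:R = a%:R) (had : (a <= d)%N)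
  (hdelta0 : 0 <= delta) (hdelta1 : delta <= 1)
  (htheta0 : 0 < theta) (htheta1 : theta < 1) :
  (alpha theta delta d != 1 ->
   forall t : nat, (1 <= t)%N ->
     mu theta delta d t =
       (alpha theta delta d ^+ t - 1) / (alpha theta delta d - 1)
       * mu1 theta delta d
     /\ sigmasq theta delta d t =
       (alpha theta delta d ^+ t - 1) / (alpha theta delta d - 1)
         * sigma1sq theta delta d
       + ((alpha theta delta d ^+ (2 * t) - alpha theta delta d ^+ t.+1
           + alpha theta delta d ^+ t - alpha theta delta d)
            / (alpha theta delta d - 1)
          - 2 * (t - 1)%:R * alpha theta delta d ^+ t)
         / (alpha theta delta d - 1) ^+ 2
         * mu1 theta delta d ^+ 2)
  /\
  (forall t : nat, (1 <= t)%N -> forall x : R, 0 < x ->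
     1 - 2 * expR (- (x ^+ 2) / 2) <=
       @condP d R t theta true
         [pred sg : config d t | (mu theta delta d t - x * Num.sqrt (sigmasq theta delta d t)
                       <= Msg a theta sg t [::])
                    && (Msg a theta sg t [::]
                       <= mu theta delta d t + x * Num.sqrt (sigmasq theta delta d t))]
     /\
     1 - 2 * expR (- (x ^+ 2) / 2) <=
       @condP d R t theta false
         [pred sg : config d t | (- mu theta delta d t - x * Num.sqrt (sigmasq theta delta d t)
                       <= Msg a theta sg t [::])
                    && (Msg a theta sg t [::]
                       <= - mu theta delta d t + x * Num.sqrt (sigmasq theta delta d t))]).
Proof.
split=> [alpha1 t t_ge1|t t_ge1 x x_gt0].
  by split; [exact: mu_closed | exact: sigmasq_closed].
have conc := Msg_concentration hdelta had hdelta1 htheta0 htheta1 _ t_ge1 x_gt0.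
split; first by have := conc true; rewrite expr0 mul1r.
by have := conc false; rewrite expr1 mulN1r.
Qed.
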